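(* Let $\Omega\subset\mathbb{R}^d$ be open and bounded, and let $F:\bar\Omega\times\mathbb{R}\times\mathbb{R}^d\times S^d\to\mathbb{R}$ be degenerate elliptic, with Dirichlet boundary conditions included in $F$ (i.e. $F(x,r,p,M)=r-g(x)$ for $x\in\partial\Omega$, where $g:\partial\Omega\to\mathbb{R}$ is given). Assume that the equation $F(x,u,\nabla u,D^2u)=0$ on $\bar\Omega$ satisfies the comparison principle, and let $u$ be its unique viscosity solution. Let $(F^\epsilon)_{\epsilon>0}$ be an approximation scheme that is consistent with this equation and nearly monotone. For each $\epsilon>0$ let $u^\epsilon\in C(\bar\Omega)$ be a solution of the scheme, i.e. $F^\epsilon[u^\epsilon](x)=0$ for all $x\in\bar\Omega$, and suppose that the family $(u^\epsilon)_{\epsilon>0}$ is stable, i.e. bounded on $\bar\Omega$ uniformly in $\epsilon$. Then $$u^\epsilon\to u\quad\text{locally uniformly on }\bar\Omega\text{ as }\epsilon\to0.$$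
   Context: $S^d$ is the set of symmetric $d\times d$ real matrices; $X\ge Y$ means $X-Y$ is positive semidefinite. **Degenerate elliptic:** $F(x,r,p,X)\le F(x,s,p,Y)$ for all $x\in\bar\Omega$, $r,s\in\mathbb{R}$, $p\in\mathbb{R}^d$, $X,Y\in S^d$ with $X\ge Y$ and $r\le s$. **Envelopes:** $F^*$ and $F_*$ denote the upper and lower semicontinuous envelopes of $F$ on $\bar\Omega\times\mathbb{R}\times\mathbb{R}^d\times S^d$: $F^*(z)=\limsup_{w\to z}F(w)$, $F_*(z)=\liminf_{w\to z}F(w)$ (with values in the extended reals; $w=z$ is allowed). **Test functions:** ''smooth function'' means $\phi\in C^2(\bar\Omega)$ (restrictions to $\bar\Omega$ of $C^2$ functions on $\mathbb{R}^d$). **Viscosity solutions:** An upper (resp. lower) semicontinuous function $u:\bar\Omega\to\mathbb{R}$ is a viscosity subsolution (resp. supersolution) if for every $\phi\in C^2(\bar\Omega)$, whenever $u-\phi$ has a local maximum (resp. minimum), relative to $\bar\Omega$, at $x\in\bar\Omega$, then $F_*(x,u(x),\nabla\phi(x),D^2\phi(x))\le0$ (resp. $F^*(x,u(x),\nabla\phi(x),D^2\phi(x))\ge0$). A viscosity solution is a function that is both a sub- and a supersolution. **Comparison principle:** if $v\in \mathrm{USC}(\bar\Omega)$ is a viscosity subsolution and $w\in \mathrm{LSC}(\bar\Omega)$ is a viscosity supersolution, then $v\le w$ on $\bar\Omega$. **Approximation scheme:** a family of functions $F^\epsilon$, $\epsilon>0$, assigning a real number $F^\epsilon(x,r,v(\cdot))$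 to each $x\in\bar\Omega$, $r\in\mathbb{R}$ and bounded function $v:\bar\Omega\to\mathbb{R}$. Write $F^\epsilon[v](x)=F^\epsilon(x,v(x),v(\cdot))$. **Consistent:** for every smooth $\phi$ and $x\in\bar\Omega$, $$\limsup_{\epsilon\to0,\,y\to x,\,\xi\to0}F^\epsilon(y,\phi(y)+\xi,\phi(\cdot)+\xi)\le F^*(x,\phi(x),\nabla\phi(x),D^2\phi(x)),$$ $$\liminf_{\epsilon\to0,\,y\to x,\,\xi\to0}F^\epsilon(y,\phi(y)+\xi,\phi(\cdot)+\xi)\ge F_*(x,\phi(x),\nabla\phi(x),D^2\phi(x)),$$ with $y\in\bar\Omega$ and $\xi\in\mathbb{R}$. **Monotone:** a scheme $F_M^\epsilon$ is monotone if for every $\epsilon>0$, $x\in\bar\Omega$, $s\in\mathbb{R}$ and bounded $v,w$ with $v\ge w$ on $\bar\Omega$, one has $F_M^\epsilon(x,s,v(\cdot))\le F_M^\epsilon(x,s,w(\cdot))$. **Perturbation:** a scheme $F_N^\epsilon$ is a perturbation if there is $m:\mathbb{R}^+\to\mathbb{R}^+$, $m\ge 0$, with $\lim_{\epsilon\to0^+}m(\epsilon)=0$ and $\sup_{v}\sup_{x\in\bar\Omega}|F_N^\epsilon[v](x)|\le m(\epsilon)$, the first supremum being over all bounded $v$. **Nearly monotone:** $F^\epsilon$ is nearly monotone if $F^\epsilon[v]=F_M^\epsilon[v]+F_N^\epsilon[v]$ for all bounded $v$, with $F_M^\epsilon$ monotone and $F_N^\epsilon$ a perturbation. *)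

(* Defs.v *)
From HB Require Import structures.
From mathcomp Require Import all_boot all_order all_algebra.
From mathcomp Require Import all_classical all_reals all_analysis.

Set Implicit Arguments.
Unset Strict Implicit.
Unset Printing Implicit Defensive.

Import Order.TTheory GRing.Theory Num.Theory.
Import numFieldNormedType.Exports.

Local Open Scope classical_set_scope.
Local Open Scope ring_scope.

(* Functions on the closure of Omega are functions on the subtype
   [set_type (closure Omega)], with its subspace topology; in particular a
   scheme only sees the values of its argument on that closure. *)

Section Calculus.
Context {R : realType} {d : nat}.
Implicit Types (phi : 'rV[R]_d -> R) (X Y : 'M[R]_d).

Definition symmx : set 'M[R]_d := [set X | X^T = X].

Definition psdmx X := forall v : 'rV[R]_d, 0 <= (v *m X *m v^T) 0 0.

Definition partial (i : 'I_d) phi : 'rV[R]_d -> R :=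
  fun x => 'D_(delta_mx 0 i) phi x.

Definition grad phi x : 'rV[R]_d := \row_i partial i phi x.

Definition hess phi x : 'M[R]_d := \matrix_(i, j) partial j (partial i phi) x.

Definition C1 phi :=
  continuous phi /\
  forall i, (forall x, derivable phi x (delta_mx 0 i)) /\
            continuous (partial i phi).

Definition C2 phi := C1 phi /\ forall i, C1 (partial i phi).

Definition boundary (A : set 'rV[R]_d) : set 'rV[R]_d :=
  closure A `\` interior A.

End Calculus.

Section Equation.
Context {R : realType} {d : nat} {Omega : set 'rV[R]_d}.

(* S^d is represented by [symmx]: F is only used at symmetric matrices, the
   envelopes are limits within them, and the Hessian of a C2 function is
   symmetric. *)
Context (F : closure Omega -> R -> 'rV[R]_d -> 'M[R]_d -> R).

Definition degenerate_elliptic :=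
  forall x r s p X Y, symmx X -> symmx Y -> psdmx (X - Y) -> r <= s ->
    F x r p X <= F x s p Y.

Definition dirichlet (g : boundary Omega -> R) :=
  forall (x : closure Omega) (b : boundary Omega), set_val x = set_val b ->
    forall r p X, symmx X -> F x r p X = r - g b.

Definition uncurryF (w : closure Omega * R * 'rV[R]_d * 'M[R]_d) : \bar R :=
  let: (x, r, p, X) := w in (F x r p X)%:E.

Definition nbhs_sym (x : closure Omega) (r : R) (p : 'rV[R]_d) (X : 'M[R]_d) :=
  within [set w : closure Omega * R * 'rV[R]_d * 'M[R]_d | symmx w.2]
    (nbhs (x, r, p, X)).

Definition upper_env x r p X : \bar R := limf_esup uncurryF (nbhs_sym x r p X).

Definition lower_env x r p X : \bar R := limf_einf uncurryF (nbhs_sym x r p X).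

Definition lsc (u : closure Omega -> R) :=
  lower_semicontinuous (fun x => (u x)%:E).

Definition usc (u : closure Omega -> R) := lsc (fun x => - u x).

Definition local_max (f : closure Omega -> R) x := \forall y \near x, f y <= f x.

Definition local_min (f : closure Omega -> R) x := \forall y \near x, f x <= f y.

Definition subsolution (u : closure Omega -> R) :=
  usc u /\
  forall phi, C2 phi -> forall x : closure Omega,
    local_max (fun y => u y - phi (set_val y)) x ->
    (lower_env x (u x) (grad phi (set_val x)) (hess phi (set_val x)) <= 0)%E.

Definition supersolution (u : closure Omega -> R) :=
  lsc u /\
  forall phi, C2 phi -> forall x : closure Omega,
    local_min (fun y => u y - phi (set_val y)) x ->
    (0 <= upper_env x (u x) (grad phi (set_val x)) (hess phi (set_val x)))%E.

Definition viscosity_solution u := subsolution u /\ supersolution u.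

Definition comparison_principle :=
  forall v w, subsolution v -> supersolution w -> forall x, v x <= w x.

End Equation.

Section Scheme.
Context {R : realType} {d : nat} {Omega : set 'rV[R]_d}.

(* [G e x r v] is only ever used for e > 0 and bounded v. *)
Definition scheme := R -> closure Omega -> R -> (closure Omega -> R) -> R.

Definition apply_scheme (G : scheme) (e : R) (v : closure Omega -> R) :
  closure Omega -> R := fun x => G e x (v x) v.

Definition consistent F (G : scheme) :=
  forall phi, C2 phi -> forall x : closure Omega,
    let Gphi (w : R * closure Omega * R) : \bar R :=
      let: (e, y, xi) := w in
      (G e y (phi (set_val y) + xi) (fun z => phi (set_val z) + xi))%:E in
    let lim_filter := filter_prod (filter_prod 0^'+ (nbhs x)) (nbhs 0) in
    let px := set_val x in
    (limf_esup Gphi lim_filter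
       <= upper_env F x (phi px) (grad phi px) (hess phi px))%E /\
    (lower_env F x (phi px) (grad phi px) (hess phi px)
       <= limf_einf Gphi lim_filter)%E.

Definition monotone_scheme (G : scheme) :=
  forall e : R, 0 < e -> forall x s (v w : closure Omega -> R),
    bounded_fun v -> bounded_fun w ->
    (forall y, w y <= v y) -> G e x s v <= G e x s w.

Definition perturbation (G : scheme) :=
  exists m : R -> R,
    [/\ forall e : R, 0 < e -> 0 <= m e,
        m @ 0^'+ --> 0 &
        forall e : R, 0 < e -> forall v : closure Omega -> R, bounded_fun v ->
          forall x, `|apply_scheme G e v x| <= m e].

Definition nearly_monotone (G : scheme) :=
  exists GM GN : scheme,
    [/\ monotone_scheme GM, perturbation GN &
        forall e : R, 0 < e -> forall v : closure Omega -> R, bounded_fun v ->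
          forall x, apply_scheme G e v x =
                    apply_scheme GM e v x + apply_scheme GN e v x].

Definition stable (ue : R -> closure Omega -> R) :=
  exists M : R, forall e : R, 0 < e -> forall x, `|ue e x| <= M.

Definition cvg_locally_uniformly
    (ue : R -> closure Omega -> R) (u : closure Omega -> R) :=
  forall x : closure Omega, exists2 U, nbhs x U & {uniform U, ue @ 0^'+ --> u}.

End Scheme.
Arguments scheme {R d} Omega.

(* Main.v *)
Require Import Defs.
From HB Require Import structures.
From mathcomp Require Import all_boot all_order all_algebra.
From mathcomp Require Import all_classical all_reals all_analysis.
From mathcomp Require Import lra ring.

Set Implicit Arguments.
Unset Strict Implicit.
Unset Printing Implicit Defensive.

Import Order.TTheory GRing.Theory Num.Theory.
Import numFieldNormedType.Exports.

Local Open Scope classical_set_scope.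
Local Open Scope ring_scope.

(** Half-relaxed limits (Barles--Souganidis). The upper relaxed limit of the
    u^eps is a subsolution: if it minus phi has a local maximum at x, adding to
    phi a constant and a large multiple of the quartic sum_i (z_i - x_i)^4
    makes the maximum global and strict without changing the gradient and the
    Hessian at x, so that for arbitrarily small eps the perturbed test function
    touches u^eps from above, up to a small constant xi, at a point near x.
    Near monotonicity then turns F^eps[u^eps] = 0 into an upper bound 2 m(eps)
    for the scheme at the test function, and consistency gives the claim.
    Dually the lower relaxed limit is a supersolution. Comparing both with u
    squeezes them onto u, and compactness of the closure makes the convergence
    uniform. *)

(** * Compactness of the closure and boundedness of functions on it *)

Lemma compact_set_type (X : topologicalType) (A : set X) :
  compact A -> compact [set: A].
Proof.
move=> cA F FF _.
have FA : (set_val @ F) A.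
  suff : F (set_val @^-1` A) by [].
  rewrite (_ : _ @^-1` _ = setT); first exact: filterT.
  by apply/seteqP; split => x // _; exact: (set_valP x).
have [a [Aa cla]] := cA (set_val @ F) _ FA.
(* Open sets of the subtype are traces of open sets [W], so a cluster point of the image filter is
   one of [F]. *)
exists (exist _ a (mem_set Aa)); split=> // U V FU [_ [[W oW <-] Wa WV]].
have FU' : F (set_val @^-1` (set_val @` U)).
  by apply: filterS FU => x Ux; exists x.
have [|z [[y Uy <-] Wy]] := cla _ W FU'; first exact: open_nbhs_nbhs.
by exists y; split => //; apply: WV.
Qed.

Lemma continuous_comp_set_val (X Y : topologicalType) (A : set X) (f : X -> Y) :
  continuous f -> continuous (fun x : A => f (set_val x)).
Proof.
move=> cf x; apply: continuous_comp; last exact: cf.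
exact: (@initial_continuous A X set_val).
Qed.

Lemma compact_closure_bounded (R : realType) (d : nat) (A : set 'rV[R]_d) :
  bounded_set A -> compact (closure A).
Proof.
move=> [M [Mreal AM]].
apply: bounded_closed_compact; last exact: closed_closure.
exists M; split => // x Mx y Ay.
apply: contrapT => /negP; rewrite -ltNge => xy.
have [|z [Az yz]] := Ay [set z | x < `|z|]; last first.
  by have := AM _ Mx _ Az; rewrite /= leNgt yz.
have cn : {for y, continuous (fun z : 'rV[R]_d => `|z|)}.
  exact: norm_continuous.
exact: (cvgr_gt _ cn).
Qed.

Lemma bounded_fun_le (R : realType) (T : Type) (f : T -> R) (B : R) :
  (forall x, `|f x| <= B) -> bounded_fun f.
Proof.
move=> fB; exists B; split; first exact: num_real.
by move=> C BC x _; exact: le_trans (fB x) (ltW BC).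
Qed.

Lemma compact_continuous_bounded (R : realType) (T : topologicalType)
    (f : T -> R) :
  compact [set: T] -> continuous f -> exists B, forall x, `|f x| <= B.
Proof.
move=> cT cf.
have /compact_bounded[B [Br fB]] : compact (f @` [set: T]).
  by apply: continuous_compact cT; exact: continuous_subspaceT.
by exists (B + 1) => x; apply: (fB (B + 1)); [rewrite ltrDl | exists x].
Qed.

(** * Upper half-relaxed limits on a topological space *)

Section RelaxedLimsup.
Context {R : realType} {T : topologicalType}.

(** The limsup of [v e y] as [e] tends to 0 from the right and [y] to [x], kept in the reals so that
    it can be a candidate solution. A uniform bound such as [vM] makes [inf] a genuine infimum. *)
Definition relaxed_limsup (v : R -> T -> R) (x : T) : R :=
  inf [set a | filter_prod 0^'+ (nbhs x) [set w | v w.1 w.2 <= a]].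

Context (v : R -> T -> R) (M : R).
Hypothesis vM : forall e, 0 < e -> forall x, `|v e x| <= M.

Lemma near_right_pos (x : T) :
  filter_prod (0 : R)^'+ (nbhs x) [set w | 0 < w.1].
Proof.
exists ([set e | 0 < e], setT).
  by split; [exact: nbhs_right_gt|exact: filterT].
by case=> e y [].
Qed.

Let has_inf_relaxed (x : T) :
  has_inf [set a | filter_prod (0 : R)^'+ (nbhs x) [set w | v w.1 w.2 <= a]].
Proof.
split.
  exists M; apply: filterS (near_right_pos x) => -[e y] /= e0.
  exact: le_trans (ler_norm _) (vM e0 _).
exists (- M) => a /= H.
have [[e y] [/= vea e0]] := filter_ex (filterI H (near_right_pos x)).
by apply: le_trans vea; have := vM e0 y; rewrite ler_norml => /andP[].
Qed.

Lemma relaxed_limsup_lt (x : T) a : relaxed_limsup v x < a ->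
  filter_prod (0 : R)^'+ (nbhs x) [set w | v w.1 w.2 < a].
Proof.
move=> /(inf_lt (proj1 (has_inf_relaxed x)))[b Hb ba].
by apply: filterS Hb => w /= /le_lt_trans; exact.
Qed.

Lemma relaxed_limsup_le (x : T) a :
  filter_prod (0 : R)^'+ (nbhs x) [set w | v w.1 w.2 <= a] ->
  relaxed_limsup v x <= a.
Proof. by move=> H; apply: ge_inf => //; case: (has_inf_relaxed x). Qed.

Lemma lt_relaxed_limsup (x : T) a A : a < relaxed_limsup v x ->
  filter_prod 0^'+ (nbhs x) A -> exists2 w, A w & a < v w.1 w.2.
Proof.
move=> ax HA; apply: contrapT => H.
suff /relaxed_limsup_le :
    filter_prod (0 : R)^'+ (nbhs x) [set w | v w.1 w.2 <= a].
  by rewrite leNgt ax.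
apply: filterS HA => w Aw /=; rewrite leNgt; apply/negP => aw.
by apply: H; exists w.
Qed.

Lemma normr_relaxed_limsup x : `|relaxed_limsup v x| <= M.
Proof.
rewrite ler_norml; apply/andP; split.
  rewrite leNgt; apply/negP => /relaxed_limsup_lt H.
  have [[e y] [/= vea e0]] := filter_ex (filterI H (near_right_pos x)).
  by have := vM e0 y; rewrite ler_norml leNgt vea.
apply: relaxed_limsup_le; apply: filterS (near_right_pos x) => -[e y] /= e0.
exact: le_trans (ler_norm _) (vM e0 _).
Qed.

(** A bound valid for [e] in [P] and [y] in [V] is an eventual bound at every interior point of
    [V]. *)
Lemma relaxed_limsup_usc :
  lower_semicontinuous (fun x => (- relaxed_limsup v x)%:E).
Proof.
move=> x a; rewrite lte_fin ltrNr => xa.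
have := midf_lt xa; set b := (_ / _) => -[xb ba].
have [[P V] [/= P0 Vx] PV] := relaxed_limsup_lt xb.
exists (interior V); first exact: nbhs_interior.
move=> y Vy; rewrite lte_fin ltrNr; apply: le_lt_trans ba.
apply: relaxed_limsup_le; exists (P, V); first by split.
by move=> w /PV /ltW.
Qed.

(** A Dini-type argument: near each point one half of [delta] covers the approach to the relaxed
    limit, the other half the semicontinuity of [f], and compactness makes the threshold on [e]
    common to all points. *)
Lemma relaxed_limsup_uniform (f : T -> R) (delta : R) :
  compact [set: T] -> lower_semicontinuous (fun x => (f x)%:E) ->
  (forall x, relaxed_limsup v x <= f x) -> 0 < delta ->
  \forall e \near 0^'+, forall x, v e x < f x + delta.
Proof.
move=> /compact_near_coveringP cT lf vf d0.
suff : \forall e \near 0^'+, [set: T] `<=` [set x | v e x < f x + delta].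
  by apply: filterS => e H x; exact: H.
apply: cT => x _.
have [V Vx Vf] := lf x (f x - delta / 2) ltac:(by rewrite lte_fin; lra).
have [[P W] [/= P0 Wx] PW] := @relaxed_limsup_lt x (f x + delta / 2)
  ltac:(by rewrite (le_lt_trans (vf x)) //; lra).
exists (W `&` V, P); first by split => //; exact: filterI.
move=> [y e] [[/= Wy Vy] Pe].
by have := PW (e, y) (conj Pe Wy); have := Vf _ Vy; rewrite /= lte_fin; lra.
Qed.

(* The weight of q makes x a strict global maximum of the relaxed limit minus
   the test function while leaving room for one unit of q, which pins the
   maximum points of v e minus the test function down near x. *)
Lemma relaxed_limsup_touch (f q : T -> R) (x : T) :
  compact [set: T] -> (forall e, 0 < e -> continuous (v e)) ->
  continuous f -> continuous q -> (forall y, 0 <= q y) -> q x = 0 ->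
  (forall U, nbhs x U -> exists2 r, 0 < r & forall y, q y < r -> U y) ->
  (\forall y \near x, relaxed_limsup v y - f y <= relaxed_limsup v x - f x) ->
  let c := relaxed_limsup v x - f x in
  exists K, forall A,
    filter_prod (filter_prod 0^'+ (nbhs x)) (nbhs (0 : R)) A ->
    exists e y xi, [/\ A (e, y, xi), 0 < e,
      v e y = f y + c + K * q y + xi &
      forall z, v e z <= f z + c + K * q z + xi].
Proof.
move=> cT cv cf cq q0 qx qU xmax c.
have [B fB] := compact_continuous_bounded cT cf.
have [r r0 rmax] := qU _ xmax.
have M0 : 0 <= M by exact: le_trans (normr_relaxed_limsup x).
have B0 : 0 <= B by exact: le_trans (fB x).
(* Where [q y >= r], the penalty is at least [2 M + 2 B], which dominates the oscillation of the
   relaxed limit minus [f]; where [q y < r], local maximality suffices. *)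
pose k := (M + M + B + B) / r.
have k0 : 0 <= k by apply: divr_ge0; [lra|exact: ltW].
have kmax y : relaxed_limsup v y <= f y + c + k * q y.
  have [/rmax /=|ry] := ltP (q y) r.
    by have : 0 <= k * q y by [exact: mulr_ge0]; rewrite /c; lra.
  have : k * r <= k * q y by exact: ler_wpM2l.
  rewrite /k divfK ?gt_eqF// /c.
  move: (normr_relaxed_limsup y) (normr_relaxed_limsup x) (fB y) (fB x).
  by rewrite !ler_norml; lra.
have cfq K : continuous (fun y => f y + c + K * q y).
  move=> y; apply: cvgD; last by apply: cvgM; [exact: cvg_cst|exact: cq].
  by apply: cvgD; [exact: cf|exact: cvg_cst].
exists (k + 1).
move=> A [[AV AX] [/= [[P V] [/= P0 Vx] PV] /nbhs_ballP[h /= h0 hX]] AVX].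
have [r' r'0 r'V] := qU _ Vx.
pose h' := Num.min h (r' / 2).
have h'0 : 0 < h' by rewrite lt_min h0 divr_gt0.
have h'h : h' <= h by rewrite ge_min lexx.
have h'r : h' <= r' / 2 by rewrite ge_min lexx orbT.
have near1 : \forall e \near 0^'+, forall y, v e y < f y + c + k * q y + h'.
  apply: relaxed_limsup_uniform => // y a; rewrite lte_fin => ay.
  exists [set z | a < f z + c + k * q z] => //.
  exact: (cvgr_gt _ (cfq k y)).
have near2 : \forall y \near x,
    f y + c + (k + 1) * q y < relaxed_limsup v x + h' / 2.
  apply: (cvgr_lt _ (cfq (k + 1) x)).
  by rewrite qx /c; lra.
(* A pair [(e, y1)] almost attaining the relaxed limit at [x]; it keeps the maximum taken below from
   falling under [- h']. *)
have [|[e y1] [[[/= e0 He] Pe] Hy1]] := @lt_relaxed_limsup x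
  (relaxed_limsup v x - h' / 2)
  [set w | ((0 < w.1 /\ forall y, v w.1 y < f y + c + k * q y + h') /\
    P w.1) /\
    f w.2 + c + (k + 1) * q w.2 < relaxed_limsup v x + h' / 2] ltac:(lra).
  exists ([set e | (0 < e /\ forall y, v e y < f y + c + k * q y + h') /\ P e],
          [set y | f y + c + (k + 1) * q y < relaxed_limsup v x + h' / 2]).
    split => //=; apply: filterI => //; apply: filterI => //.
    exact: nbhs_right_gt.
  by case.
move=> /= vy1.
have cw : continuous (fun y => v e y - (f y + c + (k + 1) * q y)).
  by move=> y; apply: cvgB; [exact: cv|exact: cfq].
have [|y _ ymax] := @compact_EVT_max T R _ _ _ cT (continuous_subspaceT cw).
  by exists x.
have {}ymax z := ymax z (mem_set I).
(* The shift [xi] is the maximum value itself, so the shifted test function touches [v e] from above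
   at [y]. *)
exists e, y, (v e y - (f y + c + (k + 1) * q y)); split => //.
(* Comparison with [y1] gives [xi > - h'], and [He] at [y] gives [xi < h' - q y]; hence [|xi| < h]
   and [q y < 2 h' <= r']. *)
- have := ymax y1; have := He y; have := q0 y => qy vy yy.
  apply: AVX; split => /=.
    apply: PV; split => //=; apply: r'V.
    by lra.
  apply: hX; rewrite /ball /= sub0r normrN ltr_norml; apply/andP; split; lra.
- by rewrite subrKC.
- by move=> z; have := ymax z; lra.
Qed.

End RelaxedLimsup.

(** * Calculus of [C2] functions and the quartic penalty *)

Section C2Theory.
Context {R : realType} {d : nat}.
Implicit Types (f g : 'rV[R]_d -> R) (x : 'rV[R]_d).

Lemma partialD f g i : C1 f -> C1 g ->
  partial i (f + g) = partial i f + partial i g.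
Proof.
move=> [_ /(_ i)[df _]] [_ /(_ i)[dg _]]; apply/funext => x.
exact: deriveD.
Qed.

Lemma C1D f g : C1 f -> C1 g -> C1 (f + g).
Proof.
move=> Cf Cg; have [cf df] := Cf; have [cg dg] := Cg; split.
  by move=> x; exact: (cvgD (cf x) (cg x)).
move=> i; have [dfi cfi] := df i; have [dgi cgi] := dg i; split.
  by move=> x; exact: derivableD.
by rewrite partialD// => x; exact: (cvgD (cfi x) (cgi x)).
Qed.

Lemma C2D f g : C2 f -> C2 g -> C2 (f + g).
Proof.
move=> [Cf Df] [Cg Dg]; split; first exact: C1D.
by move=> i; rewrite partialD//; exact: C1D.
Qed.

Lemma gradD f g x : C2 f -> C2 g -> grad (f + g) x = grad f x + grad g x.
Proof. by move=> [Cf _] [Cg _]; apply/rowP => i; rewrite !mxE partialD. Qed.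

Lemma hessD f g x : C2 f -> C2 g -> hess (f + g) x = hess f x + hess g x.
Proof.
move=> [Cf Df] [Cg Dg]; apply/matrixP => i j.
by rewrite !mxE partialD// partialD.
Qed.

Lemma is_derive_coord i j x :
  is_derive x (delta_mx 0 j) (fun z : 'rV[R]_d => z 0 i) (i == j)%:R.
Proof.
have dd := differentiable_coord x 0 i.
apply: DeriveDef; first exact: diff_derivable.
rewrite /derive.
have -> : (fun h : R => h^-1 *: (((fun z : 'rV[R]_d => z 0 i) \o shift x)
    (h *: delta_mx 0 j) - x 0 i)) = fun h : R => h^-1 * (h * (i == j)%:R).
  by apply/funext => h; rewrite /= !mxE eqxx /= addrK.
suff : h^-1 * (h * (i == j)%:R) @[h --> (0 : R)^'] --> ((i == j)%:R : R).
  by move/cvg_lim; apply.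
(* The inverse of 0 is 0, so the quotient is the constant in general only off [h = 0]. *)
have E : {near (0 : R)^',
    cst ((i == j)%:R : R) =1 fun h => h^-1 * (h * (i == j)%:R)}.
  near=> h; rewrite mulrA mulVf ?mul1r//; near: h; exact: nbhs_dnbhs_neq.
exact: cvg_trans (near_eq_cvg E) (cvg_cst _).
Unshelve. all: by end_near.
Qed.

Lemma is_derive_coordX i j (a : R) n x :
  is_derive x (delta_mx 0 j) (fun z : 'rV[R]_d => (z 0 i - a) ^+ n)
    ((n%:R * (x 0 i - a) ^+ n.-1) *+ (i == j)).
Proof.
have dc := is_derive_coord i j x.
have dc' :
    is_derive x (delta_mx 0 j) (fun z : 'rV[R]_d => z 0 i - a) (i == j)%:R.
  have := is_deriveB dc (is_derive_cst a x (delta_mx 0 j)).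
  by rewrite subr0.
have := is_deriveX n dc'.
set h := (h in is_derive _ _ h _); set h' := (h in _ -> is_derive _ _ h _).
have -> : h = h' by apply/funext => z; rewrite /h exprfctE.
by rewrite /GRing.scale /= mulr_natr.
Qed.

Lemma continuous_coordX (i : 'I_d) (a : R) n :
  continuous (fun z : 'rV[R]_d => (z 0 i - a) ^+ n).
Proof.
move=> z; apply: (@continuous_comp _ _ _
  (fun z : 'rV[R]_d => z 0 i - a) (fun r => r ^+ n)).
  exact: (cvgB (@coord_continuous R _ _ 0 i z) (cvg_cst a)).
exact: exprn_continuous.
Qed.

(** A sum over coordinates, because the norm of row vectors is the sup norm, whose powers need not
    be smooth. *)
Definition quartic (x z : 'rV[R]_d) : R := \sum_i (z 0 i - x 0 i) ^+ 4.

Lemma continuous_quartic x : continuous (quartic x).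
Proof.
apply: continuous_big => [|i _]; last exact: continuous_coordX.
exact: add_continuous.
Qed.

Lemma quartic_ge0 x z : 0 <= quartic x z.
Proof. by apply: sumr_ge0 => i _; rewrite exprn_even_ge0. Qed.

Lemma quarticxx x : quartic x x = 0.
Proof. by apply: big1 => i _; rewrite subrr expr0n. Qed.

(** Each single term is at most the whole sum, so [quartic x z < r ^+ 4] bounds every coordinate
    difference by [r]. *)
Lemma quartic_nbhs x U : nbhs x U ->
  exists2 r, 0 < r & forall z, quartic x z < r -> U z.
Proof.
move=> /nbhs_ballP[r /= r0 rU]; exists (r ^+ 4); first exact: exprn_gt0.
move=> z zr; apply: rU; split => // i j; rewrite ord1 /ball /=.
have : `|x 0 j - z 0 j| ^+ 4 < r ^+ 4.
  apply: le_lt_trans zr; rewrite distrC -normrX ger0_norm ?exprn_even_ge0//.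
  rewrite /quartic (bigD1 j)//= lerDl.
  by apply: sumr_ge0 => k _; rewrite exprn_even_ge0.
by rewrite ltr_pXn2r// nnegrE ltW.
Qed.

(** Identifying the partials as functions allows a second application to [partial i f]. *)
Lemma C1_is_derive f (df : 'I_d -> 'rV[R]_d -> R) :
  continuous f -> (forall i x, is_derive x (delta_mx 0 i) f (df i x)) ->
  (forall i, continuous (df i)) -> C1 f /\ forall i, partial i f = df i.
Proof.
move=> cf fdf cdf.
have E i : partial i f = df i.
  by apply/funext => z; rewrite /partial (@derive_val _ _ _ _ _ _ _ (fdf i z)).
split=> //; split=> // i; split; last by rewrite E.
by move=> z; exact: (@ex_derive _ _ _ _ _ _ _ (fdf i z)).
Qed.

(** A cubic factor survives in the gradient and a square in the Hessian, and both vanish at [x]. The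
    sign of [K] is free, as touching from below takes it negative. *)
Lemma C2_quartic x (c K : R) (f := fun z => c + K * quartic x z) :
  [/\ C2 f, grad f x = 0 & hess f x = 0].
Proof.
have fE : f = cst c + K \*: (\sum_i (fun z : 'rV[R]_d => (z 0 i - x 0 i) ^+ 4)).
  by apply/funext => z; rewrite /f /quartic fctE fct_sumE.
have [C1f pf] : C1 f /\
    forall i, partial i f = fun z => (K * 4) * (z 0 i - x 0 i) ^+ 3.
  apply: C1_is_derive.
  - by move=> z; exact: (cvgD (cvg_cst c)
      (cvgM (cvg_cst K) (@continuous_quartic x z))).
  - move=> i z; rewrite fE.
    apply: is_derive_eq.
      apply: is_deriveD; apply: is_deriveZ; apply: is_derive_sum => j.
      exact: is_derive_coordX.
    rewrite add0r (bigD1 i)//= eqxx big1 ?addr0 ?mulr1n /GRing.scale/= ?mulrA//.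
    by move=> j /negbTE ->.
  - move=> i z; exact: (cvgM (cvg_cst (K * 4))
      (@continuous_coordX i (x 0 i) 3 z)).
have C1pf i : C1 (partial i f) /\
    forall j, partial j (partial i f) =
      fun z => (K * 4 * 3) *+ (i == j) * (z 0 i - x 0 i) ^+ 2.
  rewrite pf; apply: C1_is_derive.
  - move=> z; exact: (cvgM (cvg_cst (K * 4))
      (@continuous_coordX i (x 0 i) 3 z)).
  - move=> j z.
    apply: (is_derive_eq
      (is_deriveZ (K * 4) (is_derive_coordX i j (x 0 i) 3 z))).
    by rewrite /GRing.scale /=; case: (i == j); rewrite ?mulr1n ?mulr0n; ring.
  - move=> j z; set k := _ *+ _.
    exact: (cvgM (cvg_cst k) (@continuous_coordX i (x 0 i) 2 z)).
split.
- by split => // i; case: (C1pf i).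
- by apply/rowP => i; rewrite !mxE pf subrr expr0n mulr0.
- apply/matrixP => i j; rewrite !mxE; have [_ ->] := C1pf i.
  by rewrite subrr expr0n /= mulr0.
Qed.

End C2Theory.

(** * Sub- and supersolution properties of the relaxed limits *)

Section Convergence.
Context {R : realType} {d : nat} {Omega : set 'rV[R]_d}.
Context (F : closure Omega -> R -> 'rV[R]_d -> 'M[R]_d -> R).
Context (G : scheme Omega).
Implicit Types (v : closure Omega -> R) (x : closure Omega).

(** Monotonicity compares [GM] only at a common value [s], hence the equality [ue e x = v x]. As
    [GM] at [ue e] is minus [GN] there, the perturbations at [ue e] and at [v] cost the original
    bound once each. *)
Lemma perturbation_touch (ue : R -> closure Omega -> R) :
  nearly_monotone G ->
  (forall e : R, 0 < e -> bounded_fun (ue e)) ->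
  (forall e : R, 0 < e -> forall x, apply_scheme G e (ue e) x = 0) ->
  exists m : R -> R, m @ 0^'+ --> 0 /\
    forall e v x, 0 < e -> bounded_fun v -> ue e x = v x ->
      ((forall y, ue e y <= v y) -> G e x (v x) v <= m e) /\
      ((forall y, v y <= ue e y) -> - m e <= G e x (v x) v).
Proof.
move=> [GM [GN [GMmono [m [_ m0 GNm]] GE]]] bue ueG.
exists (fun e => m e + m e); split.
  by rewrite -[X in _ --> X](addr0 0); exact: cvgD.
move=> e v x e0 bv vx.
have := ueG e e0 x; rewrite GE//; last exact: bue.
have := GE e e0 v bv x; rewrite /apply_scheme => ->.
have := GNm e e0 _ (bue e e0) x; have := GNm e e0 v bv x.
rewrite /apply_scheme !ler_norml vx => /andP[? ?] /andP[? ?] ?.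
split=> ley.
- by have := GMmono e e0 x (v x) v (ue e) bv (bue e e0) ley; lra.
- by have := GMmono e e0 x (v x) (ue e) v (bue e e0) bv ley; lra.
Qed.

Lemma set_val_quartic_nbhs x U : nbhs x U ->
  exists2 r, 0 < r & forall y, quartic (set_val x) (set_val y) < r -> U y.
Proof.
move=> [_ [[W oW <-] Wx WU]].
have [|r r0 rW] := @quartic_nbhs _ _ (set_val x) W; first exact: open_nbhs_nbhs.
by exists r => // y /rW; exact: WU.
Qed.

Lemma bounded_fun_set_val (f : 'rV[R]_d -> R) :
  compact [set: closure Omega] -> continuous f ->
  bounded_fun (fun z : closure Omega => f (set_val z)).
Proof.
move=> cT /continuous_comp_set_val cf.
by have [B /bounded_fun_le] := compact_continuous_bounded cT (cf _).
Qed.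

Section Solution.
Context (ue : R -> closure Omega -> R) (M : R).
Hypothesis compactO : compact [set: closure Omega].
Hypothesis consG : consistent F G.
Hypothesis monoG : nearly_monotone G.
Hypothesis cue : forall e : R, 0 < e -> continuous (ue e).
Hypothesis ueG : forall e : R, 0 < e -> forall x, apply_scheme G e (ue e) x = 0.
Hypothesis ueM : forall e, 0 < e -> forall x, `|ue e x| <= M.

Let bue (e : R) : 0 < e -> bounded_fun (ue e).
Proof. by move=> /ueM /bounded_fun_le. Qed.

Let small_right (m : R -> R) (delta : R) x A :
  m @ 0^'+ --> 0 -> 0 < delta ->
  filter_prod (filter_prod 0^'+ (nbhs x)) (nbhs (0 : R)) A ->
  filter_prod (filter_prod 0^'+ (nbhs x)) (nbhs (0 : R))
    [set w | A w /\ m w.1.1 <= delta].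
Proof.
move=> m0 d0 HA; apply: filterI => //.
exists ([set w | m w.1 <= delta], setT) => /=; last by move=> w [].
split; last exact: filterT.
exists ([set e | m e <= delta], setT); last by move=> w [].
split; last exact: filterT.
exact: (cvgr_le _ m0).
Qed.

Lemma relaxed_limsup_subsolution : subsolution F (relaxed_limsup ue).
Proof.
split; first exact: (relaxed_limsup_usc ueM).
move=> phi C2phi x xmax.
have [m [m0 mG]] := perturbation_touch monoG bue ueG.
have cphi : continuous phi by case: C2phi => -[].
have [||||||K touch] := @relaxed_limsup_touch _ _ ue M ueM
  (fun y => phi (set_val y)) (fun y => quartic (set_val x) (set_val y)) x
  compactO cue.
- exact: continuous_comp_set_val.
- exact: continuous_comp_set_val (@continuous_quartic _ _ (set_val x)).
- by move=> y; exact: quartic_ge0.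
- exact: quarticxx.
- exact: set_val_quartic_nbhs.
- exact: xmax.
set c := relaxed_limsup ue x - phi (set_val x) in touch.
(* The constant [c] lifts the value of [phi + q] at [x] to the relaxed limit, the value at which the
   equation is tested. *)
have [C2q gradq hessq] := C2_quartic (set_val x) c K.
set q := (fun z => c + _) in C2q gradq hessq.
have C2psi : C2 (phi + q) by exact: C2D.
have gE := gradD (set_val x) C2phi C2q; rewrite gradq addr0 in gE.
have hE := hessD (set_val x) C2phi C2q; rewrite hessq addr0 in hE.
have vE : (phi + q) (set_val x) = relaxed_limsup ue x.
  by rewrite fctE /q quarticxx mulr0 addr0 /c subrKC.
have [_] := consG C2psi x; rewrite gE hE vE.
(* The liminf is a supremum of infima over the sets [V] of the filter; one touching triple in [V]
   with [m e <= delta] bounds each infimum. *)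
move=> /le_trans; apply; rewrite limf_einfE; apply: ge_ereal_sup => _ [V HV <-].
apply/lee_addgt0Pr => delta d0; rewrite add0e.
have [e [y [xi [[Vw me] e0 uey uele]]]] := touch _ (small_right m0 d0 HV).
apply: (@le_trans _ _ (G e y ((phi + q) (set_val y) + xi)
  (fun z => (phi + q) (set_val z) + xi))%:E).
  by apply: ereal_inf_lbound; exists (e, y, xi).
rewrite lee_fin; apply: le_trans me.
have [||H _] := mG e (fun z => (phi + q) (set_val z) + xi) y e0.
- apply: (@bounded_fun_set_val (fun z => (phi + q) z + xi)) => // z.
  have [[cpsi _] _] := C2psi; exact: (cvgD (cpsi z) (cvg_cst xi)).
- by rewrite uey fctE /q; lra.
- by apply: H => z; rewrite fctE /q; have := uele z; lra.
Qed.

(** Only the touching argument is run on the negatives of [ue] and [phi]. The scheme need not be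
    odd, so it is still evaluated at functions touching [ue e] from below. *)
Lemma relaxed_liminf_supersolution :
  supersolution F (fun x => - relaxed_limsup (fun e y => - ue e y) x).
Proof.
have NueM e : 0 < e -> forall x, `|- ue e x| <= M.
  by move=> e0 x; rewrite normrN; exact: ueM.
split; first exact: (relaxed_limsup_usc NueM).
move=> phi C2phi x xmin.
have [m [m0 mG]] := perturbation_touch monoG bue ueG.
have cphi : continuous phi by case: C2phi => -[].
have [|||||||K touch] := @relaxed_limsup_touch _ _ (fun e y => - ue e y) M NueM
  (fun y => - phi (set_val y)) (fun y => quartic (set_val x) (set_val y)) x
  compactO.
- by move=> e e0 y; exact: (cvgN (@cue e e0 y)).
- move=> y; exact: (cvgN (@continuous_comp_set_val _ _ _ phi cphi y)).
- exact: continuous_comp_set_val (@continuous_quartic _ _ (set_val x)).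
- by move=> y; exact: quartic_ge0.
- exact: quarticxx.
- exact: set_val_quartic_nbhs.
- by apply: filterS xmin => y /=; lra.
set c := relaxed_limsup _ x - - phi (set_val x) in touch.
have [C2q gradq hessq] := C2_quartic (set_val x) (- c) (- K).
set q := (fun z => - c + _) in C2q gradq hessq.
have C2psi : C2 (phi + q) by exact: C2D.
have gE := gradD (set_val x) C2phi C2q; rewrite gradq addr0 in gE.
have hE := hessD (set_val x) C2phi C2q; rewrite hessq addr0 in hE.
have vE : (phi + q) (set_val x) = - relaxed_limsup (fun e y => - ue e y) x.
  by rewrite fctE /q quarticxx mulr0 addr0 /c; lra.
have [+ _] := consG C2psi x; rewrite gE hE vE.
apply: le_trans; rewrite limf_esupE; apply: le_ereal_inf_tmp => _ [V HV <-].
apply/lee_addgt0Pr => delta d0.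
(* Undoing the negation turns the shift [xi] into [- xi], so [V] is reflected in its last
   coordinate. *)
have HV' : filter_prod (filter_prod 0^'+ (nbhs x)) (nbhs (0 : R))
    [set w | V (w.1, - w.2)].
  case: HV => -[P X] [/= HP HX] PXV.
  exists (P, [set r | X (- r)]) => /=; last first.
    by move=> [w r] [/= Pw Xr]; exact: PXV.
  by split=> //; apply: (@opp_continuous R 0); rewrite oppr0.
have [e [y [xi [[Vw me] e0 uey uele]]]] := touch _ (small_right m0 d0 HV').
rewrite -leeBlDr// sub0e.
apply: (@le_trans _ _ (G e y ((phi + q) (set_val y) - xi)
  (fun z => (phi + q) (set_val z) - xi))%:E); last first.
  by apply: ereal_sup_ubound; exists (e, y, - xi).
rewrite lee_fin; apply: (@le_trans _ _ (- m e)); first by rewrite lerN2.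
have [||_ H] := mG e (fun z => (phi + q) (set_val z) - xi) y e0.
- apply: (@bounded_fun_set_val (fun z => (phi + q) z - xi)) => // z.
  have [[cpsi _] _] := C2psi; exact: (cvgB (cpsi z) (cvg_cst xi)).
- by rewrite fctE /q; move: uey; lra.
- by apply: H => z; rewrite fctE /q; have := uele z; lra.
Qed.

End Solution.

End Convergence.

(** * Comparison with the solution and uniform convergence *)

Theorem theorem1 (R : realType) (d : nat) (Omega : set 'rV[R]_d)
    (F : closure Omega -> R -> 'rV[R]_d -> 'M[R]_d -> R)
    (g : boundary Omega -> R)
    (u : closure Omega -> R)
    (G : scheme Omega)
    (ue : R -> closure Omega -> R) :
  open Omega ->
  bounded_set Omega ->
  degenerate_elliptic F ->
  dirichlet F g ->
  comparison_principle F ->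
  viscosity_solution F u ->
  consistent F G ->
  nearly_monotone G ->
  (forall e : R, 0 < e -> continuous (ue e)) ->
  (forall e : R, 0 < e -> forall x, apply_scheme G e (ue e) x = 0) ->
  stable ue ->
  cvg_locally_uniformly ue u.
Proof.
move=> _ bO _ _ comp [subu superu] consG monoG cue ueG [M ueM] x.
have cO := compact_set_type (compact_closure_bounded bO).
have usup := comp _ _
  (relaxed_limsup_subsolution cO consG monoG cue ueG ueM) superu.
have uinf := comp _ _
  subu (relaxed_liminf_supersolution cO consG monoG cue ueG ueM).
have NueM e : 0 < e -> forall x, `|- ue e x| <= M.
  by move=> e0 y; rewrite normrN; exact: ueM.
exists setT; first exact: filterT.
move=> P /uniform_nbhs[E [entE EP]].
move: entE; rewrite -entourage_ballE => -[delta /= d0 dE].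
(* Lower semicontinuity of [u] serves the upper bound on [ue e], and upper semicontinuity, through
   [- u], the lower bound. *)
have near1 := relaxed_limsup_uniform ueM cO superu.1 usup d0.
have near2 : \forall e \near 0^'+, forall y, - ue e y < - u y + delta.
  apply: (relaxed_limsup_uniform NueM cO subu.1 _ d0) => y.
  by rewrite lerNr; exact: uinf.
apply: filterS (filterI near1 near2) => e [ltu gtu].
apply: EP => y _; apply: dE; rewrite /= /ball /= ltr_norml.
by have := ltu y; have := gtu y; lra.
Qed.
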